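(* Let $\mathscr{A}=(a_{ijklpq})\in\mathbb{T}_{6,3}$ be a paired symmetric tensor (in particular, possibly an elasticity tensor). Then $\mathscr{A}$ is positive definite if and only if the smallest $M$-eigenvalue of $\mathscr{A}$ is positive.
   Context: $\mathbb{T}_{6,3}$ is the set of real tensors $\mathscr{A}=(a_{ijklpq})$ with $i,j,k,l,p,q\in\{1,2,3\}$. $\mathscr{A}$ is paired symmetric if $a_{ijklpq}=a_{jiklpq}=a_{ijlkpq}=a_{ijklqp}$ for all indices; a paired symmetric tensor is an elasticity tensor if moreover $a_{ijklpq}=a_{klijpq}=a_{ijpqkl}$ for all indices. For $x,y,z\in\mathbb{R}^3$, $\mathscr{A}x^2y^2z^2:=\sum_{i,j,k,l,p,q=1}^3a_{ijklpq}x_ix_jy_ky_lz_pz_q$; $\mathscr{A}$ is positive definite if $\mathscr{A}x^2y^2z^2>0$ for all $x,y,z\in\mathbb{R}^3\setminus\{0\}$. The vectors $\mathscr{A}xy^2z^2,\mathscr{A}x^2yz^2,\mathscr{A}x^2y^2z\in\mathbb{R}^3$ are defined by $(\mathscr{A}xy^2z^2)_i=\sum_{j,k,l,p,q}a_{ijklpq}x_jy_ky_lz_pz_q$, $(\mathscr{A}x^2yz^2)_k=\sum_{i,j,l,p,q}a_{ijklpq}x_ix_jy_lz_pz_q$, $(\mathscr{A}x^2y^2z)_p=\sum_{i,j,k,l,q}a_{ijklpq}x_ix_jy_ky_lz_q$. A real number $\lambda$ is an $M$-eigenvalue of a paired symmetric $\mathscr{A}$ if there exist $x,y,z\in\mathbb{R}^3$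 with $\mathscr{A}xy^2z^2=\lambda x$, $\mathscr{A}x^2yz^2=\lambda y$, $\mathscr{A}x^2y^2z=\lambda z$ and $x^\top x=y^\top y=z^\top z=1$. *)

(* Defs.v *)
From HB Require Import structures.
From mathcomp Require Import all_boot all_order all_algebra.
From mathcomp Require Import reals.

Set Implicit Arguments.
Unset Strict Implicit.
Unset Printing Implicit Defensive.

Import Order.TTheory GRing.Theory Num.Theory.
Local Open Scope ring_scope.

(* Indices range over 'I_3 = {0, 1, 2}, standing for {1, 2, 3}. *)
Definition tensor63 (R : realType) : Type :=
  'I_3 -> 'I_3 -> 'I_3 -> 'I_3 -> 'I_3 -> 'I_3 -> R.

Definition paired_symmetric (R : realType) (A : tensor63 R) : Prop :=
  forall i j k l p q : 'I_3,
    [/\ A i j k l p q = A j i k l p q,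
        A i j k l p q = A i j l k p q &
        A i j k l p q = A i j k l q p].

(* A x^2 y^2 z^2 *)
Definition tform (R : realType) (A : tensor63 R) (x y z : 'cV[R]_3) : R :=
  \sum_(i < 3) \sum_(j < 3) \sum_(k < 3) \sum_(l < 3) \sum_(p < 3) \sum_(q < 3)
    A i j k l p q * x i 0 * x j 0 * y k 0 * y l 0 * z p 0 * z q 0.

Definition positive_definite (R : realType) (A : tensor63 R) : Prop :=
  forall x y z : 'cV[R]_3,
    x != 0 -> y != 0 -> z != 0 -> 0 < tform A x y z.

(* A x y^2 z^2 *)
Definition tvec_x (R : realType) (A : tensor63 R) (x y z : 'cV[R]_3) :
    'cV[R]_3 :=
  \col_(i < 3)
    \sum_(j < 3) \sum_(k < 3) \sum_(l < 3) \sum_(p < 3) \sum_(q < 3)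
      A i j k l p q * x j 0 * y k 0 * y l 0 * z p 0 * z q 0.

(* A x^2 y z^2 *)
Definition tvec_y (R : realType) (A : tensor63 R) (x y z : 'cV[R]_3) :
    'cV[R]_3 :=
  \col_(k < 3)
    \sum_(i < 3) \sum_(j < 3) \sum_(l < 3) \sum_(p < 3) \sum_(q < 3)
      A i j k l p q * x i 0 * x j 0 * y l 0 * z p 0 * z q 0.

(* A x^2 y^2 z *)
Definition tvec_z (R : realType) (A : tensor63 R) (x y z : 'cV[R]_3) :
    'cV[R]_3 :=
  \col_(p < 3)
    \sum_(i < 3) \sum_(j < 3) \sum_(k < 3) \sum_(l < 3) \sum_(q < 3)
      A i j k l p q * x i 0 * x j 0 * y k 0 * y l 0 * z q 0.

Definition M_eigenvalue (R : realType) (A : tensor63 R) (lambda : R) : Prop :=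
  exists x y z : 'cV[R]_3,
    [/\ tvec_x A x y z = lambda *: x,
        tvec_y A x y z = lambda *: y &
        tvec_z A x y z = lambda *: z] /\
    [/\ (x^T *m x) 0 0 = 1, (y^T *m y) 0 0 = 1 & (z^T *m z) 0 0 = 1].

Definition smallest_M_eigenvalue (R : realType) (A : tensor63 R) (lambda : R) :
    Prop :=
  M_eigenvalue A lambda /\
  forall mu : R, M_eigenvalue A mu -> lambda <= mu.

(* Main.v *)
Require Import Defs.
From mathcomp Require Import all_boot all_order all_algebra.
From mathcomp Require Import reals.
From mathcomp Require Import boolp classical_sets topology normedtype derive.
From mathcomp Require Import lra ring.

Import Order.TTheory GRing.Theory Num.Theory numFieldNormedType.Exports.
Local Open Scope ring_scope.

Set Implicit Arguments.
Unset Strict Implicit.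
Unset Printing Implicit Defensive.

(** The form [A x^2 y^2 z^2] is continuous, so it attains a minimum [lambda] on
    the product of three unit spheres, and by homogeneity
    [lambda |x|^2 |y|^2 |z|^2 <= A x^2 y^2 z^2] everywhere.  Freezing two of the
    three vectors at the minimizer gives a symmetric matrix [B] such that
    [B - lambda I] is positive semidefinite and has the third vector as an
    isotropic vector, hence in its kernel: the minimizer is an eigentriple.
    Conversely an M-eigenvalue is the value of the form at its unit
    eigentriple, so [lambda] is the smallest one. *)

(** * Quadratic forms of matrices and their isotropic vectors *)

Definition qform (R : pzRingType) n (B : 'M[R]_n) (x : 'cV[R]_n) : R :=
  (x^T *m B *m x) 0 0.

Definition sqnorm (R : pzRingType) n (x : 'cV[R]_n) : R := (x^T *m x) 0 0.

Lemma sqnormE (R : pzRingType) n (x : 'cV[R]_n) :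
  sqnorm x = \sum_i x i 0 ^+ 2.
Proof. by rewrite /sqnorm mxE; apply: eq_bigr => i _; rewrite !mxE expr2. Qed.

Lemma sqnorm_ge0 (R : realDomainType) n (x : 'cV[R]_n) : 0 <= sqnorm x.
Proof. by rewrite sqnormE sumr_ge0// => i _; rewrite sqr_ge0. Qed.

Lemma sqnorm_eq0 (R : realDomainType) n (x : 'cV[R]_n) :
  (sqnorm x == 0) = (x == 0).
Proof.
apply/eqP/eqP => [|->]; last by rewrite /sqnorm mulmx0 mxE.
rewrite sqnormE => /psumr_eq0P x0; apply/colP => i; rewrite mxE.
by apply/eqP; rewrite -sqrf_eq0 x0// => j _; rewrite sqr_ge0.
Qed.

Lemma sqnorm_gt0 (R : realDomainType) n (x : 'cV[R]_n) :
  (0 < sqnorm x) = (x != 0).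
Proof. by rewrite lt0r sqnorm_ge0 andbT sqnorm_eq0. Qed.

Lemma sqnormZ (R : comPzRingType) n (a : R) (x : 'cV[R]_n) :
  sqnorm (a *: x) = a ^+ 2 * sqnorm x.
Proof.
by rewrite !sqnormE mulr_sumr; apply: eq_bigr => i _; rewrite mxE exprMn.
Qed.

Lemma qformZ (R : comPzRingType) n (B : 'M[R]_n) (a : R) (x : 'cV[R]_n) :
  qform B (a *: x) = a ^+ 2 * qform B x.
Proof.
by rewrite /qform -scalemxAr linearZ /= -!scalemxAl !mxE mulrA expr2.
Qed.

Lemma qformDZ (R : comPzRingType) n (B : 'M[R]_n) (t : R) (x d : 'cV[R]_n) :
  B^T = B ->
  qform B (x + t *: d) =
  qform B x + t * (d^T *m (B *m x)) 0 0 *+ 2 + t ^+ 2 * qform B d.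
Proof.
move=> Bsym.
(* Both sides are 1 x 1 matrices, each equal to its own transpose. *)
have sw : x^T *m B *m d = d^T *m (B *m x).
  by rewrite [LHS]mx11_scalar -tr_scalar_mx -mx11_scalar !trmx_mul trmxK Bsym.
have trE : (x + t *: d)^T = x^T + t *: d^T by rewrite linearD linearZ.
rewrite /qform trE !mulmxDl !mulmxDr.
rewrite -!scalemxAl -!scalemxAr sw -!(mulmxA _ B x).
by rewrite !mxE; ring.
Qed.

(** Moving from [x] by [- t *: (B *m x)] changes the form by [- 2 t |Bx|^2 + t^2 qform B (B *m x)],
    which is negative for small [t > 0] unless [B *m x] vanishes. *)
Lemma psd_isotropic_ker (R : realFieldType) n (B : 'M[R]_n) (x : 'cV[R]_n) :
  B^T = B -> (forall u, 0 <= qform B u) -> qform B x = 0 -> B *m x = 0.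
Proof.
move=> Bsym psd x0; apply/eqP; rewrite -sqnorm_eq0.
case: (ltgtP (sqnorm (B *m x)) 0) => // [|a0]; first by rewrite ltNge sqnorm_ge0.
set a := sqnorm _ in a0 *; set b := qform B (B *m x).
have b0 : 0 <= b by exact: psd.
have b1 : 0 < b + 1 by rewrite ltr_wpDl.
(* With [t = a / (b + 1)] one has [a = t (b + 1)], so the value collapses to [- t^2 (b + 2) < 0];
   the added 1 keeps the denominator positive when [b = 0]. *)
have := psd (x + (- (a / (b + 1))) *: (B *m x)).
rewrite qformDZ// x0 add0r -/(sqnorm _) -/a -/b.
have -> : - (a / (b + 1)) * a *+ 2 + (- (a / (b + 1))) ^+ 2 * b
          = - ((a / (b + 1)) ^+ 2 * (b + 2)) by field; rewrite gt_eqF.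
by rewrite oppr_ge0 leNgt mulr_gt0 ?exprn_gt0 ?divr_gt0 ?ltr_wpDl.
Qed.

Lemma rayleigh_min_eigen (R : realFieldType) n (B : 'M[R]_n) (lambda : R)
    (x : 'cV[R]_n) :
  B^T = B -> (forall u, lambda * sqnorm u <= qform B u) ->
  qform B x = lambda * sqnorm x -> B *m x = lambda *: x.
Proof.
move=> Bsym Bge Bx.
have qE u : qform (B - lambda%:M) u = qform B u - lambda * sqnorm u.
  rewrite /qform /sqnorm mulmxBr mulmxBl mul_mx_scalar -scalemxAl.
  by rewrite !mxE.
apply/eqP; rewrite -subr_eq0 -mul_scalar_mx -mulmxBl; apply/eqP.
apply: psd_isotropic_ker => [|u|].
- by rewrite linearB /= Bsym tr_scalar_mx.
- by rewrite qE subr_ge0.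
- by rewrite qE Bx subrr.
Qed.

(** * Slices and rotations of the tensor *)

(* Rotating the index pairs moves [y], then [z], into the first slot, so that the
   eigenvector equations in [y] and [z] reduce to the one in [x]. *)
Definition tensor_rot (R : realType) (A : tensor63 R) : tensor63 R :=
  fun i j k l p q => A p q i j k l.

Definition slice_mx (R : realType) (A : tensor63 R) (y z : 'cV[R]_3) :
    'M[R]_3 :=
  \matrix_(i, j) \sum_(k < 3) \sum_(l < 3) \sum_(p < 3) \sum_(q < 3)
    A i j k l p q * y k 0 * y l 0 * z p 0 * z q 0.

Lemma paired_symmetric_rot (R : realType) (A : tensor63 R) :
  paired_symmetric A -> paired_symmetric (tensor_rot A).
Proof.
by move=> hA i j k l p q; rewrite /tensor_rot; case: (hA p q i j k l).
Qed.

Lemma slice_mx_sym (R : realType) (A : tensor63 R) (y z : 'cV[R]_3) :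
  paired_symmetric A -> (slice_mx A y z)^T = slice_mx A y z.
Proof.
move=> hA; apply/matrixP => i j; rewrite !mxE.
do 4![apply: eq_bigr => ? _].
by rewrite [in LHS](let: And3 h _ _ := hA _ _ _ _ _ _ in h).
Qed.

Lemma tvec_x_slice (R : realType) (A : tensor63 R) (x y z : 'cV[R]_3) :
  tvec_x A x y z = slice_mx A y z *m x.
Proof.
apply/colP => i; rewrite !mxE; apply: eq_bigr => j _; rewrite !mxE.
do 4![rewrite mulr_suml; apply: eq_bigr => ? _].
by ring.
Qed.

Lemma tform_slice (R : realType) (A : tensor63 R) (x y z : 'cV[R]_3) :
  tform A x y z = qform (slice_mx A y z) x.
Proof.
rewrite /qform -mulmxA -tvec_x_slice !mxE; apply: eq_bigr => i _; rewrite !mxE.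
do 5![rewrite mulr_sumr; apply: eq_bigr => ? _].
by ring.
Qed.

Lemma tform_rot (R : realType) (A : tensor63 R) (x y z : 'cV[R]_3) :
  tform A x y z = tform (tensor_rot A) y z x.
Proof.
(* The two outer sums are pushed inside one at a time: [j] past [k, l, p, q] by [rot1], then [i]. *)
have rot2 (F : 'I_3 -> 'I_3 -> 'I_3 -> 'I_3 -> 'I_3 -> 'I_3 -> R) :
  \sum_i \sum_j \sum_k \sum_l \sum_p \sum_q F i j k l p q =
  \sum_k \sum_l \sum_p \sum_q \sum_i \sum_j F i j k l p q.
  have rot1 (G : 'I_3 -> 'I_3 -> 'I_3 -> 'I_3 -> 'I_3 -> R) :
    \sum_j \sum_k \sum_l \sum_p \sum_q G j k l p q =
    \sum_k \sum_l \sum_p \sum_q \sum_j G j k l p q.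
    by do 4![rewrite exchange_big; apply: eq_bigr => ? _].
  under eq_bigr do rewrite rot1.
  by do 4![rewrite exchange_big; apply: eq_bigr => ? _].
rewrite /tform rot2 /tensor_rot.
by do 6![apply: eq_bigr => ? _]; ring.
Qed.

Lemma tvec_y_rot (R : realType) (A : tensor63 R) (x y z : 'cV[R]_3) :
  tvec_y A x y z = tvec_x (tensor_rot A) y z x.
Proof.
apply/colP => k; rewrite !mxE /tensor_rot.
(* Each pair of exchanges brings one of [l], [p], [q] in front of both [i] and [j]. *)
under eq_bigr => i _ do rewrite exchange_big.
rewrite exchange_big; apply: eq_bigr => l _.
under eq_bigr => i _ do rewrite exchange_big.
rewrite exchange_big; apply: eq_bigr => p _.
under eq_bigr => i _ do rewrite exchange_big.
rewrite exchange_big; apply: eq_bigr => q _.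
by do 2![apply: eq_bigr => ? _]; ring.
Qed.

(** Followed by [tvec_y_rot], this reaches [tvec_x] after two rotations. *)
Lemma tvec_z_rot (R : realType) (A : tensor63 R) (x y z : 'cV[R]_3) :
  tvec_z A x y z = tvec_y (tensor_rot A) y z x.
Proof.
apply/colP => p; rewrite !mxE /tensor_rot.
have rot1 (G : 'I_3 -> 'I_3 -> 'I_3 -> 'I_3 -> R) :
  \sum_j \sum_k \sum_l \sum_q G j k l q =
  \sum_k \sum_l \sum_q \sum_j G j k l q.
  by do 3![rewrite exchange_big; apply: eq_bigr => ? _].
under eq_bigr do rewrite rot1.
do 3![rewrite exchange_big; apply: eq_bigr => ? _].
by do 2![apply: eq_bigr => ? _]; ring.
Qed.

Lemma tformZ (R : realType) (A : tensor63 R) (a : R) (x y z : 'cV[R]_3) :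
  tform A (a *: x) y z = a ^+ 2 * tform A x y z.
Proof. by rewrite !tform_slice qformZ. Qed.

(** * Continuity of the form and compactness of the spheres *)

Lemma continuous_sum_ord (R : realType) (T : topologicalType) n
    (F : 'I_n -> T -> R) :
  (forall i, continuous (F i)) -> continuous (fun u => \sum_i F i u).
Proof. by move=> cF; apply: continuous_big => //; exact: add_continuous. Qed.

(** The sphere is a closed subset of the compact cube with sides [[-1, 1]]. The transpose is there
    because [rV_compact] speaks of row vectors. *)
Lemma sphere_compact (R : realType) n :
  compact [set u : 'rV[R]_n | sqnorm u^T = 1]%classic.
Proof.
have cube : compact
    [set u : 'rV[R]_n | forall i, `[-1, 1]%classic (u ord0 i)]%classic.
  exact: (@rV_compact R n _ (fun=> @segment_compact R (-1) 1)).
apply: subclosed_compact cube _ => [|u /= u1 i].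
  apply: (@preimage_closed _ _ (fun u : 'rV[R]_n => sqnorm u^T) [set 1]%classic).
    move=> u _; have -> : (fun u : 'rV[R]_n => sqnorm u^T) =
        (fun u => \sum_i u 0 i * u 0 i).
      by apply/funext => v; rewrite sqnormE; apply: eq_bigr => i _; rewrite mxE.
    apply: continuous_sum_ord => i {}u.
    by apply: (@continuousM R _ (fun u : 'rV[R]_n => u 0 i) (fun u => u 0 i));
      exact: (@coord_continuous R 1 n 0 i).
  exact: (@closed_eq R 1).
(* A single squared coordinate is at most the whole sum of squares, which is 1. *)
rewrite in_itv /= -ler_norml -(@ler_pXn2r _ 2) ?nnegrE//.
rewrite expr1n real_normK ?num_real//.
rewrite -u1 sqnormE (bigD1 i)//= mxE lerDl sumr_ge0// => j _.
exact: sqr_ge0.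
Qed.

Lemma tform_continuous (R : realType) (A : tensor63 R) :
  continuous (fun u : 'rV[R]_3 * 'rV[R]_3 * 'rV[R]_3 =>
    tform A u.1.1^T u.1.2^T u.2^T).
Proof.
do 6![apply: continuous_sum_ord => ?].
have c11 i : continuous (fun u : 'rV[R]_3 * 'rV[R]_3 * 'rV[R]_3 => u.1.1^T i 0).
  move=> u; under eq_fun do rewrite mxE.
  apply: (@continuous_comp _ _ _ (fun u : 'rV[R]_3 * 'rV[R]_3 * 'rV[R]_3 => u.1.1)
    (fun v : 'rV[R]_3 => v 0 i)); last exact: (@coord_continuous R 1 3 0 i).
  by apply: continuous_comp; exact: cvg_fst.
have c12 i : continuous (fun u : 'rV[R]_3 * 'rV[R]_3 * 'rV[R]_3 => u.1.2^T i 0).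
  move=> u; under eq_fun do rewrite mxE.
  apply: (@continuous_comp _ _ _ (fun u : 'rV[R]_3 * 'rV[R]_3 * 'rV[R]_3 => u.1.2)
    (fun v : 'rV[R]_3 => v 0 i)); last exact: (@coord_continuous R 1 3 0 i).
  by apply: continuous_comp; [exact: cvg_fst|exact: cvg_snd].
have c2 i : continuous (fun u : 'rV[R]_3 * 'rV[R]_3 * 'rV[R]_3 => u.2^T i 0).
  move=> u; under eq_fun do rewrite mxE.
  apply: (@continuous_comp _ _ _ (fun u : 'rV[R]_3 * 'rV[R]_3 * 'rV[R]_3 => u.2)
    (fun v : 'rV[R]_3 => v 0 i)); last exact: (@coord_continuous R 1 3 0 i).
  exact: cvg_snd.
move=> u; do 6![apply: cvgM; last by [exact: c11|exact: c12|exact: c2]].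
exact: cvg_cst.
Qed.

(** * Minimization over the unit spheres *)

Lemma tform_min_on_spheres (R : realType) (A : tensor63 R) :
  exists x y z : 'cV[R]_3,
    [/\ sqnorm x = 1, sqnorm y = 1 & sqnorm z = 1] /\
    forall u v w, sqnorm u = 1 -> sqnorm v = 1 -> sqnorm w = 1 ->
      tform A x y z <= tform A u v w.
Proof.
set S := [set u : 'rV[R]_3 | sqnorm u^T = 1]%classic.
have cS : compact S by exact: sphere_compact.
have S0 : S (delta_mx 0 0).
  by rewrite /S /= /sqnorm trmxK trmx_delta mul_delta_mx mxE !eqxx.
have [|||[[x y] z]] := @compact_EVT_min _ R
    (fun u : 'rV[R]_3 * 'rV[R]_3 * 'rV[R]_3 => tform A u.1.1^T u.1.2^T u.2^T)
    (S `*` S `*` S)%classic.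
- by exists (delta_mx 0 0, delta_mx 0 0, delta_mx 0 0).
- by apply: compact_setX => //; exact: compact_setX.
- exact/continuous_subspaceT/tform_continuous.
rewrite inE /= => -[[Sx Sy] Sz] xyz_min.
exists x^T, y^T, z^T; split => // u v w u1 v1 w1.
have := xyz_min (u^T, v^T, w^T); rewrite inE /= !trmxK; apply.
by rewrite /S /= !trmxK.
Qed.

(** The form is homogeneous of degree 2 in each vector, so the unit constraints are lifted one
    vector at a time, [step] treating one variable with the others fixed. *)
Lemma tform_ge_of_spheres (R : realType) (A : tensor63 R) (lambda : R) :
  (forall u v w, sqnorm u = 1 -> sqnorm v = 1 -> sqnorm w = 1 ->
     lambda <= tform A u v w) ->
  forall u v w,
    lambda * (sqnorm u * sqnorm v * sqnorm w) <= tform A u v w.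
Proof.
have step (f : 'cV[R]_3 -> R) (mu : R) :
    (forall a u, f (a *: u) = a ^+ 2 * f u) ->
    (forall u, sqnorm u = 1 -> mu <= f u) -> forall u, mu * sqnorm u <= f u.
  move=> fZ fge u; have [->|u0] := eqVneq u 0.
    (* Writing 0 as [0 *: 0] makes homogeneity give [f 0 = 0]. *)
    by rewrite -(scale0r 0) sqnormZ fZ expr0n !mul0r mulr0.
  have u_gt0 : 0 < sqnorm u by rewrite sqnorm_gt0.
  have s2 : (Num.sqrt (sqnorm u))^-1 ^+ 2 = (sqnorm u)^-1.
    by rewrite exprVn sqr_sqrtr ?ltW.
  have := fge ((Num.sqrt (sqnorm u))^-1 *: u).
  rewrite sqnormZ fZ s2 mulVf ?gt_eqF// => /(_ erefl).
  by rewrite mulrC ler_pdivlMr.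
move=> Age u v w; rewrite !mulrA.
apply: (step (fun w => tform A u v w)) => [a t|t t1].
  (* Two rotations carry the third vector to the first slot, where [tformZ] applies. *)
  by rewrite 2!tform_rot tformZ -2!tform_rot.
apply: (step (fun v => tform A u v t)) => [a t'|t' t'1].
  by rewrite tform_rot tformZ -tform_rot.
apply: (step (fun u => tform A u t' t)) => [a t''|t'' t''1].
  exact: tformZ.
exact: Age.
Qed.

(** Freezing [y] and [z] leaves a Rayleigh minimization for the slice. The bound ranges over all
    vectors, as [rayleigh_min_eigen] requires. *)
Lemma tform_min_tvec_x (R : realType) (A : tensor63 R) (lambda : R)
    (x y z : 'cV[R]_3) :
  paired_symmetric A ->
  (forall u v w, lambda * (sqnorm u * sqnorm v * sqnorm w) <= tform A u v w) ->
  sqnorm x = 1 -> sqnorm y = 1 -> sqnorm z = 1 -> tform A x y z = lambda ->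
  tvec_x A x y z = lambda *: x.
Proof.
move=> hA Age x1 y1 z1 Axyz; rewrite tvec_x_slice.
apply: rayleigh_min_eigen => [|u|]; first exact: slice_mx_sym.
- by have := Age u y z; rewrite y1 z1 !mulr1 tform_slice.
- by rewrite -tform_slice x1 mulr1.
Qed.

(** Pairing the first eigenvector equation with the unit vector [x] gives the value of the form. *)
Lemma M_eigenvalue_tform (R : realType) (A : tensor63 R) (mu : R) :
  M_eigenvalue A mu ->
  exists x y z : 'cV[R]_3,
    [/\ sqnorm x = 1, sqnorm y = 1, sqnorm z = 1 & tform A x y z = mu].
Proof.
move=> [x [y [z [[Ax _ _] [x1 y1 z1]]]]]; exists x, y, z; split=> //.
rewrite tform_slice /qform -mulmxA -tvec_x_slice Ax -scalemxAr mxE.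
by rewrite x1 mulr1.
Qed.

Unset Implicit Arguments.

Theorem theorem3p3 (R : realType) (A : tensor63 R) (hA : paired_symmetric A) :
  exists lambda : R,
    smallest_M_eigenvalue A lambda /\ (positive_definite A <-> 0 < lambda).
Proof.
have [x [y [z [[x1 y1 z1] Amin]]]] := tform_min_on_spheres A.
have Age := tform_ge_of_spheres Amin.
have nz (u : 'cV[R]_3) : sqnorm u = 1 -> u != 0.
  by move=> u1; rewrite -sqnorm_eq0 u1 oner_eq0.
exists (tform A x y z); split; [split|split].
- exists x, y, z; split; split => //.
  + exact: tform_min_tvec_x.
  + rewrite tvec_y_rot; apply: tform_min_tvec_x => //.
    * exact: paired_symmetric_rot.
    (* Undoing the rotation turns the goal into the bound for [A] at [w, u, v], up to the order of
       the norms. *)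
    * by move=> u v w; rewrite -tform_rot -mulrA mulrC mulrA; have := Age w u v; lra.
    * by rewrite -tform_rot.
  + rewrite tvec_z_rot tvec_y_rot; apply: tform_min_tvec_x => //.
    * by do 2!apply: paired_symmetric_rot.
    * by move=> u v w; rewrite -2!tform_rot; have := Age v w u; lra.
    * by rewrite -2!tform_rot.
- by move=> mu /M_eigenvalue_tform [u [v [w [u1 v1 w1 <-]]]]; exact: Amin.
(* The minimizing vectors are unit, hence nonzero, so positive definiteness applies to them. *)
- by apply; exact: nz.
- move=> l0 u v w u0 v0 w0; apply: lt_le_trans (Age u v w).
  by rewrite !mulr_gt0 ?sqnorm_gt0.
Qed.
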